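(* Let $\gamma>0$, $\delta\ge0$, $s\in(0,1]$, and let $H(u;\gamma,\delta)=C(\delta,\gamma)(1+u)^{-1-\delta}\{1+\log(1+u)\}^{-1-\gamma}$, $u>0$, where $C(\delta,\gamma)$ is the normalizing constant. Define $f_0(z)=\phi(z;0,1)$, $f_1(z)=\int_0^\infty\phi(z;0,u)H(u;\gamma,\delta)\,du$ and $f(z)=(1-s)f_0(z)+sf_1(z)$, $z\in\mathbb{R}$, where $\phi(\cdot;0,u)$ is the $N(0,u)$ density. Let $x_1,\dots,x_n\in\mathbb{R}^p$ be fixed, let $\pi(\beta,\sigma)$ be a prior density on $\mathbb{R}^p\times(0,\infty)$, and for a data set $\mathcal{D}=\{y_1,\dots,y_n\}$ define the unnormalized posterior $$\tilde\pi_\delta(\beta,\sigma\mid\mathcal{D})=\pi(\beta,\sigma)\prod_{i=1}^n\Big\{\frac1\sigma f\Big(\frac{y_i-x_i^t\beta}{\sigma}\Big)\Big\},$$ and $\tilde\pi_\delta(\beta,\sigma\mid\mathcal{D}^* )$ the analogous product over $i\in\mathcal{K}$ only, where $\mathcal{D}^*=\{y_i:i\in\mathcal{K}\}$. Let $\{1,\dots,n\}=\mathcal{K}\cup\mathcal{L}$ be a disjoint partition and suppose $y_i=y_i(\omega)$ depends on a parameter $\omega$ such that $y_i(\omega)$ is constant for $i\in\mathcal{K}$ and $|y_i(\omega)|\to\infty$ as $\omega\to\infty$ for $i\in\mathcal{L}$. Then for any compact set $K\subset\mathbb{R}^p\times(0,\infty)$, $$\frac{\tilde\pi_\delta(\beta,\sigma\mid\mathcal{D})}{\tilde\pi_\delta(\beta,\sigma\mid\mathcal{D}^*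 )}\Big/\prod_{i\in\mathcal{L}}f(y_i)\ \longrightarrow\ \sigma^{2|\mathcal{L}|\delta}$$ uniformly in $(\beta,\sigma)\in K$ as $\omega\to\infty$. In particular, the unnormalized posterior is robust (the limit equals $1$) if and only if $\delta=0$.
   Context: The ratio of unnormalized posteriors equals $\prod_{i\in\mathcal{L}}\frac1\sigma f((y_i-x_i^t\beta)/\sigma)$, and the prior density is assumed positive so that the ratio is defined. *)

(* Defs.v *)
From HB Require Import structures.
From mathcomp Require Import all_boot all_order all_algebra.
From mathcomp Require Import all_classical all_reals all_analysis.
Set Implicit Arguments. Unset Strict Implicit. Unset Printing Implicit Defensive.
Import Order.TTheory GRing.Theory Num.Theory.
Import numFieldNormedType.Exports.
Local Open Scope classical_set_scope.
Local Open Scope ring_scope.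

Section Defs.
Variable R : realType.

Definition phi (z u : R) : R :=
  (Num.sqrt (2 * pi * u))^-1 * expR (- (z ^+ 2) / (2 * u)).

Definition Hraw (gamma delta u : R) : R :=
  (1 + u) `^ (-1 - delta) * (1 + ln (1 + u)) `^ (-1 - gamma).

Definition Cnorm (gamma delta : R) : R :=
  (fine (\int[@lebesgue_measure R]_(u in `]0%R, +oo[) (Hraw gamma delta u)%:E))^-1.

Definition H (gamma delta u : R) : R := Cnorm gamma delta * Hraw gamma delta u.

Definition f0 (z : R) : R := phi z 1.

Definition f1 (gamma delta z : R) : R :=
  fine (\int[@lebesgue_measure R]_(u in `]0%R, +oo[) (phi z u * H gamma delta u)%:E).

Definition fmix (gamma delta s z : R) : R :=
  (1 - s) * f0 z + s * f1 gamma delta z.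

Definition upost (gamma delta s : R) (n p : nat) (X : 'M[R]_(n, p))
  (prior : 'cV[R]_p -> R -> R) (A : {set 'I_n}) (y : 'I_n -> R)
  (beta : 'cV[R]_p) (sigma : R) : R :=
  prior beta sigma *
  \prod_(i in A) (sigma^-1 * fmix gamma delta s ((y i - (X *m beta) i 0) / sigma)).

End Defs.

(* Main.v *)
Require Import Defs.
From HB Require Import structures.
From mathcomp Require Import all_boot all_order all_algebra.
From mathcomp Require Import all_classical all_reals all_analysis.
From mathcomp Require Import measurable_realfun ring lra.
Set Implicit Arguments. Unset Strict Implicit. Unset Printing Implicit Defensive.
Import Order.TTheory GRing.Theory Num.Theory.
Import numFieldNormedType.Exports.
Local Open Scope classical_set_scope.
Local Open Scope ring_scope.

(** Only the scaling behaviour of the tail of [f] matters, not its exact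
asymptotics. Substituting [u = l^2 v] in the mixture integral gives
[f1 (l z) = l * \int phi(z; 0, v) H(l^2 v) dv], and
[l^(2 + 2 delta) H(l^2 v) / H(v)] tends to 1 as [v -> oo], uniformly for [l] in
a compact subset of the positive reals. The part [v <= V] of the integral is at
most a constant times [exp(- z^2 / (4 V))], which is negligible because
[f1 z] is at least a constant times [exp(- z^2 / (8 V))]. The normal component
is negligible for the same reason, so [l^(1 + 2 delta) f(l z) / f(z) -> 1]
uniformly in [l] as [|z| -> oo]. Finally [(y - b) / sigma = l y] with
[l = (1 - b / y) / sigma], which stays in a compact set. *)

Lemma continuous_powR_pos (R : realType) (a x : R) :
  0 < x -> {for x, continuous (@powR R ^~ a)}.
Proof.
move=> x0; apply: differentiable_continuous; apply/derivable1_diffP.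
by apply: derivable_powR; rewrite in_itv/= x0.
Qed.

(** * The mixing density [Hraw]: continuity, monotonicity, integrability *)

Section density.
Variable R : realType.
Implicit Types (gamma delta u v z : R).
Local Notation mu := (@lebesgue_measure R).

Lemma one_add_ln_ge1 u : 0 <= u -> 1 <= 1 + ln (1 + u).
Proof. by move=> u0; rewrite lerDl ln_ge0// lerDl. Qed.

Lemma continuous_one_add_ln u : 0 <= u ->
  {for u, continuous (fun x : R => 1 + ln (1 + x))}.
Proof.
move=> u0; apply: cvgD; first exact: cvg_cst.
apply: (@cvg_comp _ _ _ (fun x => 1 + x) (@ln R) _ (nbhs (1 + u))).
  by apply: cvgD; [exact: cvg_cst|exact: cvg_id].
by apply: continuous_ln; rewrite ltr_wpDr.
Qed.

Lemma continuous_Hraw gamma delta u : 0 <= u ->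
  {for u, continuous (Hraw gamma delta)}.
Proof.
move=> u0; apply: cvgM.
  apply: (@cvg_comp _ _ _ (fun x => 1 + x) (@powR R ^~ (-1 - delta)) _
    (nbhs (1 + u))).
    by apply: cvgD; [exact: cvg_cst|exact: cvg_id].
  by apply: continuous_powR_pos; rewrite ltr_wpDr.
apply: (@cvg_comp _ _ _ (fun x => 1 + ln (1 + x)) (@powR R ^~ (-1 - gamma)) _
  (nbhs (1 + ln (1 + u)))).
  exact: continuous_one_add_ln.
by apply: continuous_powR_pos; rewrite (lt_le_trans _ (one_add_ln_ge1 u0)).
Qed.

Lemma Hraw_gt0 gamma delta u : 0 <= u -> 0 < Hraw gamma delta u.
Proof.
move=> u0; apply: mulr_gt0; apply: powR_gt0; first by rewrite ltr_wpDr.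
by rewrite (lt_le_trans _ (one_add_ln_ge1 u0)).
Qed.

Lemma powR_antitone (a x y : R) : 0 <= a -> 0 < x -> x <= y ->
  y `^ (-1 - a) <= x `^ (-1 - a).
Proof.
move=> a0 x0 xy; have y0 := lt_le_trans x0 xy.
rewrite -opprD !powRN lef_pV2 ?posrE ?powR_gt0//.
by apply: (ge0_ler_powR _ _ _ xy); rewrite ?addr_ge0// nnegrE ltW.
Qed.

Lemma Hraw_antitone gamma delta u v : 0 <= gamma -> 0 <= delta ->
  0 <= u -> u <= v -> Hraw gamma delta v <= Hraw gamma delta u.
Proof.
move=> g0 d0 u0 uv; apply: ler_pM; rewrite ?powR_ge0//; apply: powR_antitone => //.
- by rewrite ltr_wpDr.
- by rewrite lerD2l.
- by rewrite (lt_le_trans _ (one_add_ln_ge1 u0)).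
- by rewrite lerD2l ler_ln ?posrE ?lerD2l// ltr_wpDr// (le_trans u0).
Qed.

Lemma Hraw_le1 gamma delta u : 0 <= gamma -> 0 <= delta -> 0 <= u ->
  Hraw gamma delta u <= 1.
Proof.
move=> g0 d0 u0; apply: le_trans (Hraw_antitone g0 d0 (lexx 0) u0) _.
by rewrite /Hraw addr0 ln1 addr0 !powR1 mulr1.
Qed.

Lemma measurable_pos_continuous (f : R -> R) :
  (forall u, 0 < u -> {for u, continuous f}) ->
  measurable_fun (`]0, +oo[ : set R) f.
Proof.
move=> cf; apply: open_continuous_measurable_fun => // u.
by rewrite inE/= in_itv/= andbT; exact: cf.
Qed.

Lemma ln_cvgy : (@ln R) x @[x --> +oo] --> +oo.
Proof.
apply/cvgryPge => A; near=> x.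
have x0 : 0 < x by near: x; exact: nbhs_pinfty_gt.
rewrite -ler_expR lnK ?posrE//; near: x; exact: nbhs_pinfty_ge.
Unshelve. all: by end_near. Qed.

Lemma powR_cvgy (a : R) : 0 < a -> x `^ a @[x --> +oo] --> +oo.
Proof.
move=> a0; apply/cvgryPge => A; near=> x.
have x0 : 0 < x by near: x; exact: nbhs_pinfty_gt.
(* The threshold inverts the power; the maximum with 0 covers a negative [A]. *)
have : (Num.max A 0) `^ a^-1 <= x by near: x; exact: nbhs_pinfty_ge.
move=> /(@ge0_ler_powR _ a (ltW a0)).
rewrite ?nnegrE ?powR_ge0// (ltW x0) => /(_ isT isT).
rewrite -powRrM mulVf ?gt_eqF// powRr1 ?le_max ?lexx ?orbT//.
by apply: le_trans; rewrite le_max lexx.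
Unshelve. all: by end_near. Qed.

Lemma powRN_cvg0 (a : R) : 0 < a -> x `^ (- a) @[x --> +oo] --> 0.
Proof.
move=> a0; rewrite (_ : (fun x => _) = (fun x : R => (x `^ a)^-1)); last first.
  by apply/funext => x; rewrite powRN.
apply/gtr0_cvgV0; last exact: powR_cvgy.
by near=> x; apply: powR_gt0; near: x; exact: nbhs_pinfty_gt.
Unshelve. all: by end_near. Qed.

(** For [delta = 0] there is an explicit antiderivative, [- gamma^-1 (1 + ln (1 + u))^(- gamma)],
    which vanishes at infinity because [gamma > 0]. *)
Lemma integral_Hraw_lty gamma : 0 < gamma ->
  (\int[mu]_(u in `]0%R, +oo[) (Hraw gamma 0 u)%:E < +oo)%E.
Proof.
move=> g0.
have mH : measurable_fun (`]0, +oo[ : set R) (Hraw gamma 0).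
  by apply: measurable_pos_continuous => u u0; apply: continuous_Hraw; exact: ltW.
rewrite integral_itv_obnd_cbnd; last exact/measurable_EFinP.
pose F u := - gamma^-1 * (1 + ln (1 + u)) `^ (- gamma).
have dF u : 0 <= u -> is_derive u 1 F (Hraw gamma 0 u).
  move=> u0.
  have L0 : 0 < 1 + ln (1 + u) by rewrite (lt_le_trans _ (one_add_ln_ge1 u0)).
  have u1 : 0 < 1 + u by rewrite ltr_wpDr.
  have H1 : is_derive u 1 (fun x : R => 1 + x) 1.
    by apply: is_derive_eq; rewrite add0r mulr1.
  have H2 := is_derive1_ln u1.
  have H3 := is_derive1_powR (- gamma) L0.
  have H5 : is_derive u 1 (fun x : R => 1 + ln (1 + x)) (1 + u)^-1.
    by apply: is_derive_eq; rewrite add0r mulr1 mul1r.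
  have H6 : is_derive u 1 (fun x : R => (1 + ln (1 + x)) `^ (- gamma))
      (- gamma * (1 + ln (1 + u)) `^ (- gamma - 1) * (1 + u)^-1).
    exact: (@is_derive1_comp _ (@powR R ^~ (- gamma)) (fun x => 1 + ln (1 + x))).
  apply: (@is_derive_eq _ _ _ (fun x : R => - gamma^-1 * (1 + ln (1 + x)) `^ (- gamma))).
  rewrite /Hraw subr0 powR_inv1 ?ltW// (addrC (-1)).
  by rewrite /GRing.scale/=; field; rewrite ?gt_eqF//.
(* The two zeros are the left endpoint and the limit of [F] at infinity. *)
rewrite (@ge0_continuous_FTC2y _ (Hraw gamma 0) F 0 0).
- by rewrite -EFinD ltry.
- by move=> x x0; exact/ltW/Hraw_gt0.
- apply/continuous_within_itvcyP; split.
    by move=> x; rewrite in_itv/= andbT => x0; apply: continuous_Hraw; exact: ltW.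
  by apply: cvg_at_right_filter; exact: continuous_Hraw.
- rewrite -[0 in X in _ --> X](mulr0 (- gamma^-1)); apply: cvgMr.
  apply: (@cvg_comp _ _ _ (fun x => 1 + ln (1 + x)) (fun y => y `^ (- gamma))
    _ (@pinfty_nbhs R)); last first.
    exact: powRN_cvg0.
  apply/cvgryPge => A; near=> x.
  rewrite -lerBlDl; near: x.
  have /cvgryPge := ln_cvgy; move=> /(_ (A - 1)) [M [Mr HM]].
  exists M; split => // x Mx; apply: HM; rewrite (lt_trans Mx)// ltrDr//.
- by move=> x x0; have [] := dF _ (ltW x0).
- apply: cvg_at_right_filter.
  apply: differentiable_continuous; apply/derivable1_diffP.
  by have [] := dF _ (lexx 0).
- move=> x; rewrite in_itv/= andbT => x0; rewrite derive1E.
  by have [_ ->] := dF _ (ltW x0).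
Unshelve. all: by end_near. Qed.

Lemma ge0_le_integrable (D : set R) (f g : R -> R) :
  measurable D -> measurable_fun D f ->
  (forall u, D u -> 0 <= f u <= g u) ->
  mu.-integrable D (EFin \o g) -> mu.-integrable D (EFin \o f).
Proof.
move=> mD mf fg; apply: le_integrable => //; first exact/measurable_EFinP.
move=> u /fg /andP[f0 fg'] /=.
by rewrite lee_fin !ger0_norm// (le_trans f0).
Qed.

(** Since [1 + u >= 1], the density for [delta = 0] dominates the one for any [delta >= 0]. *)
Lemma integrable_Hraw gamma delta : 0 < gamma -> 0 <= delta ->
  mu.-integrable `]0, +oo[ (EFin \o Hraw gamma delta).
Proof.
move=> g0 d0.
have mH d : measurable_fun (`]0, +oo[ : set R) (Hraw gamma d).
  by apply: measurable_pos_continuous => u u0; apply: continuous_Hraw; exact: ltW.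
apply: (@ge0_le_integrable _ _ (Hraw gamma 0)) => //.
- move=> u /=; rewrite in_itv/= andbT => u0.
  apply/andP; split; first exact/ltW/Hraw_gt0/ltW.
  apply: ler_wpM2r; first exact: powR_ge0.
  apply: ler_powR; first by rewrite lerDl ltW.
  by rewrite lerD2l oppr0 oppr_le0.
- apply/integrableP; split; first by apply/measurable_EFinP; exact: mH.
  under eq_integral do rewrite /= ger0_norm ?mulr_ge0 ?powR_ge0//.
  exact: integral_Hraw_lty.
Qed.

End density.

(** * Bounds on the normal density as a function of its variance, and integrability of the
    mixture *)

Section gaussian_mixture.
Variable R : realType.
Implicit Types (gamma delta u v z : R).
Local Notation mu := (@lebesgue_measure R).

Lemma phi_gt0 z u : 0 < u -> 0 < phi z u.
Proof.
move=> u0; rewrite mulr_gt0 ?expR_gt0// invr_gt0 sqrtr_gt0.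
by rewrite !mulr_gt0 ?pi_gt0.
Qed.

Lemma continuous_phi z u : 0 < u -> {for u, continuous (phi z)}.
Proof.
move=> u0; apply: cvgM.
  apply: cvgV; first by rewrite gt_eqF// sqrtr_gt0 !mulr_gt0 ?pi_gt0.
  apply: (@cvg_comp _ _ _ (fun x => 2 * pi * x) (@Num.sqrt R) _
    (nbhs (2 * pi * u))); last exact: sqrt_continuous.
  by apply: cvgM; [exact: cvg_cst|exact: cvg_id].
apply: (@cvg_comp _ _ _ (fun x => - z ^+ 2 / (2 * x)) (@expR R) _
    (nbhs (- z ^+ 2 / (2 * u)))); last exact: continuous_expR.
apply: cvgM; first exact: cvg_cst.
apply: cvgV; first by rewrite gt_eqF// mulr_gt0.
by apply: cvgM; [exact: cvg_cst|exact: cvg_id].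
Qed.

(** With [x = z^2 / (2 u)] the product is [sqrt (x / pi) * exp (- x)]. Using [exp x >= 1 + x] and
    squaring, the claim becomes [x <= pi (1 + x)^2]. The bound is uniform in [u], including near the
    singularity at 0. *)
Lemma norm_phi_le1 z u : 0 < u -> `|z| * phi z u <= 1.
Proof.
move=> u0; pose x := z ^+ 2 / (2 * u).
have x0 : 0 <= x by rewrite divr_ge0 ?sqr_ge0// mulr_ge0// ltW.
have p2 : 2 <= pi :> R by exact: pi_ge2.
have pu0 : 0 < 2 * pi * u by rewrite !mulr_gt0 ?pi_gt0.
have zE : z ^+ 2 = x * (2 * u) by rewrite /x; field; rewrite gt_eqF.
rewrite /phi mulNr -/x expRN -invfM.
rewrite ler_pdivrMr ?mul1r ?mulr_gt0 ?expR_gt0 ?sqrtr_gt0//.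
apply: (@le_trans _ _ (Num.sqrt (2 * pi * u) * (1 + x))); last first.
  by rewrite ler_wpM2l ?sqrtr_ge0// expR_ge1Dx.
rewrite -(@ler_pXn2r _ 2) ?nnegrE ?mulr_ge0 ?sqrtr_ge0 ?addr_ge0//.
rewrite exprMn sqr_sqrtr ?(ltW pu0)// -normrX ger0_norm ?sqr_ge0// zE.
have -> : 2 * pi * u * (1 + x) ^+ 2 = pi * (1 + x) ^+ 2 * (2 * u) by ring.
rewrite ler_wpM2r ?mulr_ge0 ?(ltW u0)//.
apply: (@le_trans _ _ (1 * (1 + x) ^+ 2)); last first.
  by rewrite ler_wpM2r ?sqr_ge0//; lra.
by rewrite mul1r; nra.
Qed.

(* Half of the exponent is spent on absorbing the singularity of [u^(-1/2)] at 0. *)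
Lemma phi_le_exp (V z u : R) : 0 < u <= V -> 1 <= `|z| ->
  phi z u <= 2 * expR (- z ^+ 2 / (4 * V)).
Proof.
move=> /andP[u0 uV] z1; have V0 := lt_le_trans u0 uV.
have -> : phi z u = phi (z / Num.sqrt 2) u * expR (- z ^+ 2 / (4 * u)).
  rewrite /phi -[RHS]mulrA -expRD expr_div_n sqr_sqrtr//; congr (_ * expR _).
  by field; rewrite gt_eqF.
apply: ler_pM; rewrite ?expR_ge0 ?(ltW (phi_gt0 _ u0))//.
  have s1 : Num.sqrt 2 <= 2 :> R.
    by rewrite -[leRHS]ger0_norm// -sqrtr_sqr ler_wsqrtr//; lra.
  have s0 : 0 < Num.sqrt 2 :> R by rewrite sqrtr_gt0.
  have := norm_phi_le1 (z / Num.sqrt 2) u0.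
  rewrite normrM normfV (ger0_norm (ltW s0)) mulrAC ler_pdivrMr// mul1r.
  move=> h; apply: le_trans (le_trans h s1).
  by rewrite ler_peMl// ltW// phi_gt0.
rewrite ler_expR !mulNr lerN2 ler_wpM2l ?sqr_ge0// lef_pV2 ?posrE ?mulr_gt0//.
by rewrite ler_wpM2l.
Qed.

Lemma phi_le_phi0 z u : 0 < u -> phi z u <= phi 0 u.
Proof.
move=> u0; rewrite /phi expr0n/= oppr0 mul0r expR0 ler_wpM2l ?invr_ge0 ?sqrtr_ge0//.
by rewrite expR_le1 mulNr oppr_le0 divr_ge0 ?sqr_ge0// mulr_ge0// ltW.
Qed.

Lemma phi0_le u : 0 < u -> phi 0 u <= (Num.sqrt u)^-1.
Proof.
move=> u0; rewrite /phi expr0n/= oppr0 mul0r expR0 mulr1.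
have p2 : 2 <= pi :> R by exact: pi_ge2.
rewrite lef_pV2 ?posrE ?sqrtr_gt0 ?mulr_gt0 ?pi_gt0//.
by rewrite ler_wsqrtr// ler_peMl ?(ltW u0)//; lra.
Qed.

(** On each [[1 / (n + 1), 1]] the antiderivative [2 sqrt u] bounds the integral by 2; these
    intervals increase to []0, 1]], so the bound passes to the limit. *)
Lemma integrable_inv_sqrt :
  mu.-integrable `]0, 1] (fun u => (Num.sqrt u)^-1%:E).
Proof.
have cf u : 0 < u -> {for u, continuous (fun v : R => (Num.sqrt v)^-1)}.
  move=> u0; apply: cvgV; last exact: sqrt_continuous.
  by rewrite gt_eqF// sqrtr_gt0.
have mf (D : set R) : D `<=` `]0, +oo[ -> measurable_fun D (fun v : R => (Num.sqrt v)^-1).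
  move=> DP; have := measurable_pos_continuous cf.
  by apply: measurable_funS => //; exact: measurable_itv.
apply/integrableP; split.
  by apply/measurable_EFinP; apply: mf => u /=; rewrite !in_itv/= andbT => /andP[].
under eq_integral do rewrite /= ger0_norm ?invr_ge0 ?sqrtr_ge0//.
apply: (@le_lt_trans _ _ 2%:E); last exact: ltry.
rewrite itv_open_bnd_bigcup.
have pos n u : `[(0 + n.+1%:R^-1)%R, 1%R]%classic u -> 0 < u :> R.
  by rewrite /= in_itv/= add0r => /andP[+ _]; apply: lt_le_trans; rewrite invr_gt0.
apply: (cvge_le _ (ge0_nondecreasing_set_cvg_integral _ _ _ _)) => //=.
- near=> n.
  have n1 : (0 < n)%N by near: n; exact: nbhs_infty_gt.
  have a0 : 0 < 0 + n.+1%:R^-1 :> R by rewrite add0r invr_gt0.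
  rewrite (@continuous_FTC2 _ _ (fun v => 2 * Num.sqrt v)).
  + rewrite -EFinB lee_fin sqrtr1 mulr1 lerBlDr lerDl.
    by rewrite mulr_ge0// sqrtr_ge0.
  + by rewrite add0r invf_lt1// ltr1n.
  + apply: continuous_in_subspaceT => u; rewrite inE => /pos; exact: cf.
  + have c u : {for u, continuous (fun v : R => 2 * Num.sqrt v)}.
      by apply: cvgM; [exact: cvg_cst|exact: sqrt_continuous].
    split.
    * move=> u; rewrite in_itv/= => /andP[/(lt_trans a0) u0 _].
      by apply: ex_derive; apply: is_deriveZ; exact: is_derive1_sqrt.
    * by apply: cvg_at_right_filter; exact: c.
    * by apply: cvg_at_left_filter; exact: c.
  + move=> u; rewrite in_itv/= => /andP[/(lt_trans a0) u0 _].
    rewrite derive1E; have H := is_derive1_sqrt u0.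
    have [_ ->] := is_deriveZ 2 H.
    by rewrite /GRing.scale/= invfM mulrA divff// mul1r.
- move=> m n mn; rewrite subsetEset => u /=; rewrite !in_itv/= !add0r => /andP[h ->].
  rewrite andbT; apply: le_trans h.
  by rewrite lef_pV2 ?posrE// ler_nat.
- by move=> n; apply/measurable_EFinP; apply: mf => u /pos /=; rewrite in_itv/= andbT.
Unshelve. all: by end_near. Qed.

Lemma measurable_phiH gamma delta z :
  measurable_fun (`]0, +oo[ : set R) (fun u => phi z u * Hraw gamma delta u).
Proof.
apply: measurable_pos_continuous => u u0; apply: cvgM.
  exact: continuous_phi.
exact/continuous_Hraw/ltW.
Qed.

(* The case [z = 0] is what makes [f 0] finite and hence the posterior of the
   data in [Kset] nonzero. *)
Lemma integrable_phiH gamma delta z : 0 < gamma -> 0 <= delta ->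
  mu.-integrable `]0, +oo[ (EFin \o (fun u => phi z u * Hraw gamma delta u)).
Proof.
move=> g0 d0.
(* Dominating function: up to 1 use [phi z u <= u^(-1/2)] and [Hraw <= 1]; beyond 1 the same bound
   gives [phi z u <= 1], which leaves [Hraw]. *)
pose g := (fun u : R => (Num.sqrt u)^-1) \_ `]0, 1].
apply: (@ge0_le_integrable _ _ _ (fun u => g u + Hraw gamma delta u)) => //.
- exact: measurable_phiH.
- move=> u /=; rewrite in_itv/= andbT => u0.
  have h0 := Hraw_gt0 gamma delta (ltW u0).
  have h1 := Hraw_le1 (ltW g0) d0 (ltW u0).
  have p0 := phi_gt0 z u0.
  have p1 := le_trans (phi_le_phi0 z u0) (phi0_le u0).
  have s0 : 0 < (Num.sqrt u)^-1 by rewrite invr_gt0 sqrtr_gt0.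
  apply/andP; split; first by rewrite mulr_ge0// ltW.
  rewrite /g patchE; case: ifPn => [_|].
    apply: (@le_trans _ _ (phi z u)); first by rewrite ler_piMr// ltW.
    by rewrite (le_trans p1)// lerDl ltW.
  rewrite notin_setE/= in_itv/= u0/= => /negP; rewrite -ltNge => u1.
  rewrite add0r ler_piMl ?(ltW h0)// (le_trans p1)//.
  by rewrite invf_le1 ?sqrtr_gt0// -sqrtr1 ler_wsqrtr// ltW.
- rewrite (_ : EFin \o _ = (EFin \o g) \+ (EFin \o Hraw gamma delta))//.
  apply: integrableD => //; last exact: integrable_Hraw.
  rewrite /g -restrict_EFin; apply/integrable_restrict => //.
  rewrite setIidr; first exact: integrable_inv_sqrt.
  by move=> u /=; rewrite !in_itv/= andbT => /andP[].
Qed.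

End gaussian_mixture.

(** Expand [x y - 1 = (x - 1) (y - 1) + (x - 1) + (y - 1)]. The cap at 1 makes the quadratic term no
    larger than a linear one, so three terms of size [e / 3] remain. *)
Lemma mul_near1 (R : realFieldType) (x y e : R) :
  `|x - 1| <= Num.min 1 (e / 3) -> `|y - 1| <= Num.min 1 (e / 3) ->
  `|x * y - 1| <= e.
Proof.
set e1 := Num.min _ _ => hx hy.
have e11 : e1 <= 1 by rewrite ge_min lexx.
have e1e : e1 <= e / 3 by rewrite ge_min lexx orbT.
have -> : x * y - 1 = (x - 1) * (y - 1) + (x - 1) + (y - 1) by ring.
apply: (le_trans (ler_normD _ _)); apply: (le_trans (lerD (ler_normD _ _) (lexx _))).
rewrite normrM.
have : `|x - 1| * `|y - 1| <= e1 * 1 by apply: ler_pM => //; exact: le_trans e11.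
by lra.
Qed.

(** * Change of scale in Lebesgue measure and in the mixing density *)

Section scaling.
Variable R : realType.
Implicit Types (gamma delta u v z l : R).
Local Notation mu := (@lebesgue_measure R).

(** The rescaled pushforward is a measure with the right value on every interval []x, y]], and these
    values determine Lebesgue measure. *)
Lemma lebesgue_measure_scale (c : R) (A : set R) : 0 < c -> measurable A ->
  mu A = (c%:E * mu (( *%R c) @^-1` A))%E.
Proof.
move=> c0 mA.
pose f : measurableTypeR R -> measurableTypeR R := *%R c.
have mf : measurable_fun setT f by exact: mulrl_measurable.
pose m : {measure set (measurableTypeR R) -> \bar R} := mscale (NngNum (ltW c0)) (pushforward mu f).
rewrite (@lebesgue_measure_unique _ (m mf))//= => _ [[x y]] _ <-.
have pre : ( *%R c) @^-1` `]x, y] = `]x / c, y / c]%classic.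
  by apply/seteqP; split => u /=; rewrite !in_itv/= ltr_pdivrMr// ler_pdivlMr// mulrC.
transitivity (c%:E * mu `](x / c)%R, (y / c)%R]%classic)%E; last first.
  by rewrite /m /= /mscale /pushforward -pre.
rewrite !lebesgue_measure_itv/= !lte_fin ltr_pM2r ?invr_gt0//.
case: ifPn => _; last by rewrite mule0.
by rewrite -!EFinB -EFinM; congr EFin; field; rewrite gt_eqF.
Qed.

Lemma Rintegral_scale (c : R) (f : R -> R) : 0 < c ->
  measurable_fun (`]0, +oo[ : set R) f -> (forall u, 0 < u -> 0 <= f u) ->
  \int[mu]_(u in `]0, +oo[) f u = c * \int[mu]_(u in `]0, +oo[) f (c * u).
Proof.
move=> c0 mf f0.
pose g : measurableTypeR R -> measurableTypeR R := *%R c.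
have mg : measurable_fun setT g by exact: mulrl_measurable.
pose m : {measure set (measurableTypeR R) -> \bar R} := mscale (NngNum (ltW c0)) (pushforward mu g).
have mPf : measurable_fun (`]0, +oo[ : set R) (EFin \o f) by exact/measurable_EFinP.
have fP u : `]0%R, +oo[%classic u -> (0 <= (EFin \o f) u)%E.
  by rewrite /= in_itv/= andbT lee_fin => /f0.
rewrite /Rintegral.
have -> : (\int[mu]_(u in `]0%R, +oo[) (f u)%:E = \int[m mg]_(u in `]0%R, +oo[) (f u)%:E)%E.
  by apply: eq_measure_integral => A mA _; exact: lebesgue_measure_scale.
rewrite /m ge0_integral_mscale//= ge0_integral_pushforward//=; last first.
  by move=> u; rewrite inE; exact: fP.
have -> : (g @^-1` `]0%R, +oo[%classic) = (`]0%R, +oo[%classic : set (measurableTypeR R)).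
  by apply/seteqP; split => u /=; rewrite !in_itv/= !andbT pmulr_rgt0.
(* An infinite integral stays infinite after multiplication by [c], and [fine] sends it to 0 on both
   sides. *)
case: (\int[mu]_(u in `]0%R, +oo[) (f (c * u))%:E)%E => [r| |];
  by rewrite ?gt0_muley ?gt0_muleNy ?lte_fin//= mulr0.
Qed.

Lemma cvg_powR1 (p : R) : x `^ p @[x --> (1 : R)] --> (1 : R).
Proof.
have := @continuous_powR_pos _ p (1 : R) ltr01.
by rewrite /prop_for /continuous_at/= powR1.
Qed.

Lemma near_ln_gt (M : R) : \forall x \near +oo, M < ln x.
Proof. by have /cvgryPgt := @ln_cvgy R; exact. Qed.

(** Isolates the dependence on [l] in two ratios that tend to 1 as [v] grows: the prefactor cancels
    the power of [l^2] pulled out of the base [1 + l^2 v]. *)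
Lemma Hraw_scaleE gamma delta l v : 0 < l -> 0 < v ->
  (l ^+ 2) `^ (1 + delta) * Hraw gamma delta (l ^+ 2 * v) =
  ((1 + l ^+ 2 * v) / (l ^+ 2 * (1 + v))) `^ (-1 - delta) *
  ((1 + ln (1 + l ^+ 2 * v)) / (1 + ln (1 + v))) `^ (-1 - gamma) *
  Hraw gamma delta v.
Proof.
move=> l0 v0; have l20 : 0 < l ^+ 2 by rewrite exprn_gt0.
have lv0 : 0 <= l ^+ 2 * v by rewrite mulr_ge0 ?ltW.
have v1 : 0 < 1 + v by rewrite addr_gt0.
have lv1 : 0 < 1 + l ^+ 2 * v by rewrite ltr_wpDr.
have L1 := lt_le_trans (@ltr01 R) (one_add_ln_ge1 (ltW v0)).
have L2 := lt_le_trans (@ltr01 R) (one_add_ln_ge1 lv0).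
rewrite /Hraw; set x := _ / (l ^+ 2 * _); set y := _ / (1 + ln _).
have x0 : 0 < x by rewrite divr_gt0// mulr_gt0.
have y0 : 0 < y by rewrite divr_gt0.
have -> : 1 + l ^+ 2 * v = x * (l ^+ 2) * (1 + v).
  by rewrite /x; field; rewrite !gt_eqF.
have -> : 1 + ln (x * l ^+ 2 * (1 + v)) = y * (1 + ln (1 + v)).
  rewrite /y divfK ?gt_eqF//; congr (1 + ln _).
  by rewrite /x; field; rewrite !gt_eqF.
rewrite (powRM _ (mulr_ge0 (ltW x0) (ltW l20)) (ltW v1)).
rewrite (powRM _ (ltW x0) (ltW l20)) (powRM _ (ltW y0) (ltW L1)).
have E : (l ^+ 2) `^ (1 + delta) * (l ^+ 2) `^ (-1 - delta) = 1.
  by rewrite -opprD powRN divff// gt_eqF// powR_gt0.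
by rewrite -[RHS]mul1r -[X in _ = X * _]E; ring.
Qed.

(** The ratios in [Hraw_scaleE] differ from 1 by [(l^-2 - 1) / (1 + v)] and
    [ln q / (1 + ln (1 + v))], where [q = (1 + l^2 v) / (1 + v)]. The numerators are bounded for [l]
    in [[a, A]] and the denominators tend to infinity; continuity of the two powers at 1
    concludes. *)
Lemma Hraw_scale_near gamma delta (a A e : R) :
  0 < a -> 0 < e ->
  \forall v \near +oo, forall l, a <= l <= A ->
  `|(l ^+ 2) `^ (1 + delta) * Hraw gamma delta (l ^+ 2 * v) -
    Hraw gamma delta v| <= e * Hraw gamma delta v.
Proof.
move=> a0 e0; pose e1 := Num.min 1 (e / 3).
have e10 : 0 < e1 by rewrite lt_min ltr01 divr_gt0.
have pc p : exists2 d, 0 < d & forall x : R, `|x - 1| < d -> `|x `^ p - 1| < e1.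
  have /cvgrPdist_lt /(_ _ e10) [d /= d0 H] := cvg_powR1 p.
  by exists d => // x; rewrite distrC => /H; rewrite distrC.
have [d1 d10 H1] := pc (-1 - delta).
have [d2 d20 H2] := pc (-1 - gamma).
have a2 : 0 < a ^+ 2 by rewrite exprn_gt0.
(* [B] bounds [|ln q|]: the inequality [ln t <= t - 1] at [q] and at [q^-1] gives [ln q <= l^2] and
   [- ln q <= l^-2]. *)
pose B := 1 + A ^+ 2 + (a ^+ 2)^-1.
near=> v => l /andP[al lA].
have v0 : 0 < v by near: v; exact: nbhs_pinfty_gt.
have l0 := lt_le_trans a0 al.
have l20 : 0 < l ^+ 2 by rewrite exprn_gt0.
have al2 : a ^+ 2 <= l ^+ 2 by rewrite lerXn2r// nnegrE ltW.
have lA2 : l ^+ 2 <= A ^+ 2 by rewrite lerXn2r// nnegrE (le_trans (ltW l0)).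
have il2 : (l ^+ 2)^-1 <= (a ^+ 2)^-1 by rewrite lef_pV2.
have il20 : 0 < (l ^+ 2)^-1 by rewrite invr_gt0.
have lv0 : 0 < l ^+ 2 * v by rewrite mulr_gt0.
have v1 : 0 < 1 + v by rewrite addr_gt0.
have lv1 : 0 < 1 + l ^+ 2 * v by rewrite addr_gt0.
have L1 := lt_le_trans (@ltr01 R) (one_add_ln_ge1 (ltW v0)).
rewrite Hraw_scaleE//; set x := _ / (l ^+ 2 * _); set y := _ / (1 + ln _).
have Bx : `|x - 1| < d1.
  have -> : x - 1 = ((l ^+ 2)^-1 - 1) / (1 + v).
    by rewrite /x; field; rewrite !gt_eqF.
  rewrite normrM normfV (ger0_norm (ltW v1)) ltr_pdivrMr//.
  apply: (@le_lt_trans _ _ ((a ^+ 2)^-1 + 1)).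
    have aux (p r : R) : 0 < p -> p <= r -> `|p - 1| <= r + 1.
      by move=> p0 pr; rewrite ler_norml; apply/andP; split; lra.
    exact: aux.
  rewrite mulrC -ltr_pdivrMr//; apply: (@lt_trans _ _ v); last by rewrite ltrDr.
  by near: v; apply: nbhs_pinfty_gt; exact: num_real.
have By : `|y - 1| < d2.
  pose q := (1 + l ^+ 2 * v) / (1 + v).
  have q0 : 0 < q by rewrite divr_gt0.
  have lnq : `|ln q| <= B.
    have lnle (t : R) : 0 < t -> ln t <= t - 1.
      by move=> t0; rewrite -{1}(subrK 1 t) addrC; apply: le_ln1Dx; rewrite ltrBrDl addrN.
    have h1 := lnle _ q0.
    have := lnle q^-1; rewrite invr_gt0 => /(_ q0); rewrite lnV ?posrE// => h2.
    have q1 : q <= 1 + l ^+ 2.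
      by rewrite ler_pdivrMr//; nra.
    have q2 : q^-1 <= 1 + (l ^+ 2)^-1.
      rewrite invf_div ler_pdivrMr//.
      have -> : (1 + (l ^+ 2)^-1) * (1 + l ^+ 2 * v) = 1 + v + l ^+ 2 * v + (l ^+ 2)^-1.
        by field; rewrite gt_eqF.
      by lra.
    by rewrite ler_norml /B; apply/andP; split; lra.
  have -> : y - 1 = ln q / (1 + ln (1 + v)).
    rewrite /q ln_div ?posrE// /y.
    by field; rewrite gt_eqF.
  rewrite normrM normfV (ger0_norm (ltW L1)) ltr_pdivrMr//.
  apply: le_lt_trans lnq _.
  rewrite mulrC -ltr_pdivrMr//.
  apply: (@lt_le_trans _ _ (ln v)); first by near: v; exact: near_ln_gt.
  apply: (@le_trans _ _ (ln (1 + v))); last by rewrite lerDr.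
  by rewrite ler_ln ?posrE// lerDr.
have h0 := Hraw_gt0 gamma delta (ltW v0).
rewrite -[X in _ - X]mul1r -mulrBl normrM (ger0_norm (ltW h0)) ler_wpM2r ?(ltW h0)//.
by apply: mul_near1; apply/ltW; [exact: H1|exact: H2].
Unshelve. all: by end_near. Qed.

End scaling.

(** * The scale mixture under a rescaling of its argument *)

Section mixture_tail.
Variable R : realType.
Implicit Types (gamma delta s u v z l : R).
Local Notation mu := (@lebesgue_measure R).
Local Notation P := (`]0%R, +oo[%classic : set R).

(** This is [f1] without the constant [Cnorm]. *)
Definition gmix gamma delta z : R :=
  \int[mu]_(u in P) (phi z u * Hraw gamma delta u).

Lemma integrable_EFinD (D : set R) (f g : R -> R) : measurable D ->
  mu.-integrable D (EFin \o f) -> mu.-integrable D (EFin \o g) ->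
  mu.-integrable D (EFin \o (fun u => f u + g u)).
Proof.
move=> mD fi gi.
rewrite (_ : EFin \o _ = (EFin \o f) \+ (EFin \o g))//; exact: integrableD.
Qed.

Lemma integrable_EFinZl (D : set R) (c : R) (f : R -> R) : measurable D ->
  mu.-integrable D (EFin \o f) ->
  mu.-integrable D (EFin \o (fun u => c * f u)).
Proof.
move=> mD fi.
rewrite (_ : EFin \o _ = (fun u => c%:E * (EFin \o f) u)%E)//; exact: integrableZl.
Qed.

Lemma Rintegral_dist_le (D : set R) (f g b : R -> R) : measurable D ->
  mu.-integrable D (EFin \o f) -> mu.-integrable D (EFin \o g) ->
  mu.-integrable D (EFin \o b) ->
  (forall u, D u -> `|f u - g u| <= b u) ->
  `|\int[mu]_(u in D) f u - \int[mu]_(u in D) g u| <= \int[mu]_(u in D) b u.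
Proof.
move=> mD fi gi bi fgb.
have I1 : \int[mu]_(u in D) f u <= \int[mu]_(u in D) (g u + b u).
  apply: le_Rintegral => //; first exact: integrable_EFinD.
  by move=> u /fgb; rewrite ler_norml; lra.
have I2 : \int[mu]_(u in D) g u <= \int[mu]_(u in D) (f u + b u).
  apply: le_Rintegral => //; first exact: integrable_EFinD.
  by move=> u /fgb; rewrite ler_norml; lra.
move: I1 I2; rewrite !RintegralD// ler_norml; lra.
Qed.

Lemma integrable_cst_indic (A : set R) (m r : R) : measurable A ->
  mu A = r%:E -> mu.-integrable P (EFin \o (fun u => m * \1_A u)).
Proof.
move=> mA muA; apply: integrable_EFinZl => //.
apply: (@integrableS _ _ _ _ setT) => //.
apply/integrableP; split; first exact/measurable_EFinP.
under eq_integral do rewrite /= ger0_norm//.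
rewrite integral_indic// setIT.
by apply: (@le_lt_trans _ _ r%:E); [rewrite -muA|exact: ltry].
Qed.

Lemma Rintegral_cst_indic (A : set R) (m r : R) : measurable A -> A `<=` P ->
  mu A = r%:E -> \int[mu]_(u in P) (m * \1_A u) = m * r.
Proof.
move=> mA AP muA; rewrite RintegralZl//; last first.
  have := integrable_cst_indic 1 mA muA.
  by congr (integrable _ _ _); apply/funext => u /=; rewrite mul1r.
rewrite /Rintegral integral_indic// setIidl//.
exact: (congr1 (fun x => m * fine x) muA).
Qed.

(** Comparison with [m] times the indicator of [[x, y]]. Both the positivity of the normalizing
    constant and the lower tail bound come from it. *)
Lemma Rintegral_ge_itv (f : R -> R) (m x y : R) :
  mu.-integrable P (EFin \o f) -> (forall u, 0 < u -> 0 <= f u) ->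
  0 < x <= y -> (forall u, x <= u <= y -> m <= f u) ->
  m * (y - x) <= \int[mu]_(u in P) f u.
Proof.
move=> fi f0 /andP[x0 xy] mf.
have muA : mu `[x, y] = (y - x)%:E.
  rewrite lebesgue_measure_itv/= lte_fin; case: ltP => // yx.
  by have -> : y = x; [apply/eqP; rewrite eq_le yx xy|rewrite subrr].
rewrite -(@Rintegral_cst_indic `[x, y] m (y - x))//; last first.
  by move=> u /=; rewrite !in_itv/= andbT => /andP[+ _]; exact: lt_le_trans.
apply: le_Rintegral => //; first exact: (integrable_cst_indic _ _ muA).
move=> u; rewrite /= in_itv/= andbT => u0; rewrite indicE.
have [|] := boolP (u \in `[x, y]%classic).
  by rewrite inE/= in_itv/= mulr1 => /mf.
by rewrite mulr0 => _; exact: f0.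
Qed.

Lemma phi_scale l z v : 0 < l -> phi (l * z) (l ^+ 2 * v) = l^-1 * phi z v.
Proof.
move=> l0; rewrite /phi [RHS]mulrA; congr (_ * expR _).
  have -> : 2 * pi * (l ^+ 2 * v) = l ^+ 2 * (2 * pi * v) by ring.
  by rewrite sqrtrM ?sqr_ge0// sqrtr_sqr ger0_norm ?(ltW l0)// invfM.
(* The inverse of 0 is 0, so both exponents vanish at [v = 0]. *)
have [->|v0] := eqVneq v 0; first by rewrite !mulr0 invr0 !mulr0.
by field; rewrite v0 gt_eqF.
Qed.

Lemma measurable_phiH_scale gamma delta l z : 0 < l ->
  measurable_fun P (fun v => phi z v * Hraw gamma delta (l ^+ 2 * v)).
Proof.
move=> l0; apply: measurable_pos_continuous => u u0; apply: cvgM.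
  exact: continuous_phi.
apply: (@cvg_comp _ _ _ (fun x => l ^+ 2 * x) (Hraw gamma delta) _
    (nbhs (l ^+ 2 * u))); last first.
  by apply: continuous_Hraw; rewrite mulr_ge0 ?sqr_ge0 ?(ltW u0).
by apply: cvgM; [exact: cvg_cst|exact: cvg_id].
Qed.

(** Serves to dominate the rescaled integrand. Beyond some [W], the comparison of [Hraw_scale_near]
    with relative error 1 gives the factor [2 / k]; up to [W], the left side is at most 1 while
    [Hraw] at [v] is at least its value at [W]. *)
Lemma Hraw_scale_bounded gamma delta l : 0 < gamma -> 0 <= delta -> 0 < l ->
  exists c : R, forall v, 0 < v ->
  Hraw gamma delta (l ^+ 2 * v) <= c * Hraw gamma delta v.
Proof.
move=> g0 d0 l0; pose k := (l ^+ 2) `^ (1 + delta).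
have l20 : 0 < l ^+ 2 by rewrite exprn_gt0.
have k0 : 0 < k by rewrite powR_gt0.
have [V [Vr HV]] := @Hraw_scale_near R gamma delta l l 1 l0 ltr01.
pose W := Num.max V 0; have W0 : 0 <= W by rewrite le_max lexx orbT.
have hW := Hraw_gt0 gamma delta W0.
exists (2 / k + (Hraw gamma delta W)^-1) => v v0.
have hv := Hraw_gt0 gamma delta (ltW v0).
have lv0 : 0 < l ^+ 2 * v by rewrite mulr_gt0.
rewrite mulrDl; have [vW|Wv] := leP v W.
  apply: (@le_trans _ _ 1); first exact: Hraw_le1 (ltW g0) d0 (ltW lv0).
  apply: (@le_trans _ _ ((Hraw gamma delta W)^-1 * Hraw gamma delta v)).
    by rewrite ler_pdivlMl// mulr1; apply: Hraw_antitone => //; exact: ltW.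
  by rewrite lerDr mulr_ge0 ?(ltW hv)// divr_ge0 ?(ltW k0).
apply: (@le_trans _ _ (2 / k * Hraw gamma delta v)); last first.
  by rewrite lerDl mulr_ge0 ?(ltW hv)// invr_ge0 ltW.
have Vv : V < v by apply: le_lt_trans Wv; rewrite le_max lexx.
have := HV v Vv l; rewrite lexx => /(_ isT); rewrite mul1r -/k ler_norml => /andP[_ h].
by rewrite [leRHS]mulrAC ler_pdivlMr// [leLHS]mulrC; lra.
Qed.

Lemma integrable_phiH_scale gamma delta l z :
  0 < gamma -> 0 <= delta -> 0 < l ->
  mu.-integrable P (EFin \o (fun v => phi z v * Hraw gamma delta (l ^+ 2 * v))).
Proof.
move=> g0 d0 l0; have [c Hc] := Hraw_scale_bounded g0 d0 l0.
apply: (@ge0_le_integrable _ _ _ (fun v => c * (phi z v * Hraw gamma delta v))) => //.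
- exact: measurable_phiH_scale.
- move=> v /=; rewrite in_itv/= andbT => v0.
  have p0 := ltW (phi_gt0 z v0).
  apply/andP; split; last by rewrite [leRHS]mulrCA ler_wpM2l ?Hc.
  by rewrite mulr_ge0// ltW// Hraw_gt0// mulr_ge0 ?sqr_ge0// ltW.
- by apply: integrable_EFinZl => //; exact: integrable_phiH.
Qed.

(** The Jacobian [l^2] meets the factor [l^-1] from [phi_scale]. *)
Lemma gmix_scale gamma delta l z : 0 < gamma -> 0 <= delta -> 0 < l ->
  gmix gamma delta (l * z) =
  l * \int[mu]_(v in P) (phi z v * Hraw gamma delta (l ^+ 2 * v)).
Proof.
move=> g0 d0 l0; have l20 : 0 < l ^+ 2 by rewrite exprn_gt0.
rewrite /gmix (Rintegral_scale l20); last 2 first.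
- exact: measurable_phiH.
- by move=> u u0; rewrite mulr_ge0 ?(ltW (phi_gt0 _ u0)) ?(ltW (Hraw_gt0 _ _ (ltW u0))).
under eq_Rintegral do rewrite phi_scale// -mulrA.
rewrite RintegralZl//; last exact: integrable_phiH_scale.
by rewrite mulrA expr2 mulrK// unitfE gt_eqF.
Qed.

(** Reconciles the exponent [2 + 2 delta] of the mixing density with the exponent [1 + 2 delta] of
    the mixture; the extra [l] is the one produced by [gmix_scale]. *)
Lemma powR_sqr_1D delta l : 0 < l ->
  (l ^+ 2) `^ (1 + delta) = l `^ (1 + 2 * delta) * l.
Proof.
move=> l0.
transitivity (l `^ (1 + 2 * delta) * l `^ 1); last by rewrite powRr1// ltW.
rewrite -powRD; last by rewrite (gt_eqF l0) implybT.
rewrite -powR_mulrn ?(ltW l0)// -powRrM; congr (_ `^ _); ring.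
Qed.

(** The integrands are compared pointwise. Beyond [V] the relative error [e] integrates to
    [e * gmix]. On []0, V]], of length [V], [phi_le_exp] bounds the kernel, and [Hraw <= 1] bounds
    the difference of the densities by [k + 1]. *)
Lemma gmix_compare gamma delta (a A e V l z : R) :
  0 < gamma -> 0 <= delta -> 0 < a -> 0 < V -> 0 <= e ->
  (forall v, V < v -> forall l, a <= l <= A ->
    `|(l ^+ 2) `^ (1 + delta) * Hraw gamma delta (l ^+ 2 * v) -
      Hraw gamma delta v| <= e * Hraw gamma delta v) ->
  1 <= `|z| -> a <= l <= A ->
  `|l `^ (1 + 2 * delta) * gmix gamma delta (l * z) - gmix gamma delta z| <=
  e * gmix gamma delta z +
  2 * ((A ^+ 2) `^ (1 + delta) + 1) * V * expR (- z ^+ 2 / (4 * V)).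
Proof.
move=> g0 d0 a0 V0 e0 HV z1 alA; have /andP[al lA] := alA.
have l0 := lt_le_trans a0 al.
set k := (A ^+ 2) `^ (1 + delta); set X := expR _.
have kl : (l ^+ 2) `^ (1 + delta) <= k.
  by apply: ge0_ler_powR; rewrite ?addr_ge0// ?nnegrE ?sqr_ge0// lerXn2r// nnegrE ltW// (lt_le_trans l0).
have kl0 : 0 < (l ^+ 2) `^ (1 + delta) by rewrite powR_gt0// exprn_gt0.
rewrite gmix_scale// mulrA -powR_sqr_1D//.
rewrite -RintegralZl//; last exact: integrable_phiH_scale.
have mI : mu `]0, V] = V%:E by rewrite lebesgue_measure_itv/= lte_fin V0 oppr0 addr0.
pose b u := e * (phi z u * Hraw gamma delta u) + (2 * (k + 1) * X) * \1_(`]0, V]) u.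
have iH := integrable_phiH z g0 d0.
have iI : mu.-integrable P (EFin \o (fun u => (2 * (k + 1) * X) * \1_(`]0, V]) u)).
  exact: (integrable_cst_indic _ _ mI).
have -> : e * gmix gamma delta z + 2 * (k + 1) * V * X = \int[mu]_(u in P) b u.
  rewrite RintegralD//; last exact: integrable_EFinZl.
  rewrite RintegralZl//; congr (_ + _); rewrite (@Rintegral_cst_indic _ _ V)//; first ring.
  by move=> u /=; rewrite !in_itv/= andbT => /andP[].
apply: Rintegral_dist_le => //.
- by apply: integrable_EFinZl => //; exact: integrable_phiH_scale.
- by apply: integrable_EFinD => //; exact: integrable_EFinZl.
move=> u; rewrite /= in_itv/= andbT => u0; rewrite /b.
have p0 := phi_gt0 z u0.
have h0 := Hraw_gt0 gamma delta (ltW u0).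
have h1 := Hraw_le1 (ltW g0) d0 (ltW u0).
have lu0 : 0 <= l ^+ 2 * u by rewrite mulr_ge0 ?sqr_ge0// ltW.
have h0' := Hraw_gt0 gamma delta lu0.
have h1' := Hraw_le1 (ltW g0) d0 lu0.
have -> : (l ^+ 2) `^ (1 + delta) * (phi z u * Hraw gamma delta (l ^+ 2 * u)) -
    phi z u * Hraw gamma delta u =
    phi z u * ((l ^+ 2) `^ (1 + delta) * Hraw gamma delta (l ^+ 2 * u) -
      Hraw gamma delta u) by ring.
rewrite normrM (ger0_norm (ltW p0)) indicE.
have [uV|Vu] := leP u V.
  rewrite mem_set/= ?in_itv/= ?u0// mulr1.
  apply: (@le_trans _ _ (2 * (k + 1) * X)); last first.
    by rewrite lerDr mulr_ge0// mulr_ge0// ltW.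
  have hk : `|(l ^+ 2) `^ (1 + delta) * Hraw gamma delta (l ^+ 2 * u) -
      Hraw gamma delta u| <= k + 1.
    have : (l ^+ 2) `^ (1 + delta) * Hraw gamma delta (l ^+ 2 * u) <= k * 1.
      by apply: ler_pM => //; exact: ltW.
    have : 0 <= (l ^+ 2) `^ (1 + delta) * Hraw gamma delta (l ^+ 2 * u).
      by rewrite mulr_ge0// ltW.
    by rewrite ler_norml; lra.
  have -> : 2 * (k + 1) * X = (2 * X) * (k + 1) by ring.
  by apply: ler_pM => //; [exact: ltW|apply: phi_le_exp => //; rewrite u0].
rewrite memNset/= ?in_itv/= ?u0/= ?mulr0 ?addr0; last by apply/negP; rewrite -ltNge.
by rewrite [leRHS]mulrCA ler_wpM2l ?HV// ltW.
Qed.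

End mixture_tail.

(** * Lower tail bound and regular variation of the error density *)

Section mixture_regular_variation.
Variable R : realType.
Implicit Types (gamma delta s u v z l : R).
Local Notation mu := (@lebesgue_measure R).

(** Keep only [u] in [[4 V, 5 V]]: there [z^2 / (2 u) <= z^2 / (8 V)], and the remaining factors are
    at least their values at [5 V]. The decay rate is half that of the error in [gmix_compare],
    which makes this error negligible. *)
Lemma gmix_lower gamma delta (V : R) : 0 < gamma -> 0 <= delta -> 0 < V ->
  exists2 c : R, 0 < c &
    forall z, c * expR (- z ^+ 2 / (8 * V)) <= gmix gamma delta z.
Proof.
move=> g0 d0 V0.
have V5 : 0 < 5 * V by rewrite mulr_gt0.
have s0 : 0 < (Num.sqrt (2 * pi * (5 * V)))^-1 by rewrite invr_gt0 sqrtr_gt0 !mulr_gt0 ?pi_gt0.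
have h0 := Hraw_gt0 gamma delta (ltW V5).
exists ((Num.sqrt (2 * pi * (5 * V)))^-1 * Hraw gamma delta (5 * V) * V).
  by apply: mulr_gt0 => //; exact: mulr_gt0.
move=> z; set E := expR _; have E0 : 0 < E by exact: expR_gt0.
have -> : (Num.sqrt (2 * pi * (5 * V)))^-1 * Hraw gamma delta (5 * V) * V * E =
  (Num.sqrt (2 * pi * (5 * V)))^-1 * E * Hraw gamma delta (5 * V) * (5 * V - 4 * V) by ring.
apply: Rintegral_ge_itv.
- exact: integrable_phiH.
- by move=> u u0; rewrite mulr_ge0// ltW ?phi_gt0 ?Hraw_gt0// ltW.
- by apply/andP; split; lra.
move=> u /andP[u4 u5].
have u0 : 0 < u by lra.
apply: ler_pM; rewrite ?(ltW h0)//; first by rewrite mulr_ge0// ltW.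
  apply: ler_pM; rewrite ?(ltW s0) ?(ltW E0)//.
    rewrite lef_pV2 ?posrE ?sqrtr_gt0 ?mulr_gt0 ?pi_gt0//.
    by rewrite ler_wsqrtr// ler_wpM2l// mulr_ge0// pi_ge0.
  rewrite ler_expR !mulNr lerN2 ler_wpM2l ?sqr_ge0// lef_pV2 ?posrE ?mulr_gt0//; lra.
by apply: Hraw_antitone => //; exact: ltW.
Qed.

(** The integral is at least the value of [Hraw] at 2 times the length of [[1, 2]]; integrability
    matters because [fine] would turn an infinite integral into 0. *)
Lemma Cnorm_gt0 gamma delta : 0 < gamma -> 0 <= delta -> 0 < Cnorm gamma delta.
Proof.
move=> g0 d0; rewrite invr_gt0.
apply: (@lt_le_trans _ _ (Hraw gamma delta 2 * (2 - 1))).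
  rewrite mulr_gt0 ?Hraw_gt0//; lra.
apply: (@Rintegral_ge_itv _ (Hraw gamma delta)).
- exact: integrable_Hraw.
- by move=> u u0; apply/ltW/Hraw_gt0/ltW.
- lra.
- move=> u /andP[u1 u2]; apply: Hraw_antitone => //; [exact: ltW|lra].
Qed.

Lemma f1E gamma delta z : 0 < gamma -> 0 <= delta ->
  f1 gamma delta z = Cnorm gamma delta * gmix gamma delta z.
Proof.
move=> g0 d0; rewrite -RintegralZl//; last exact: integrable_phiH.
by apply: eq_Rintegral => u _; rewrite /H; ring.
Qed.

Lemma gmix_gt0 gamma delta z : 0 < gamma -> 0 <= delta -> 0 < gmix gamma delta z.
Proof.
move=> g0 d0; have [c c0 Hc] := gmix_lower g0 d0 (@ltr01 R).
by apply: lt_le_trans (Hc z); rewrite mulr_gt0 ?expR_gt0.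
Qed.

Lemma fmix_ge gamma delta s z : 0 < gamma -> 0 <= delta -> 0 < s <= 1 ->
  s * Cnorm gamma delta * gmix gamma delta z <= fmix gamma delta s z.
Proof.
move=> g0 d0 /andP[s0 s1]; rewrite /fmix f1E// mulrA lerDr mulr_ge0 ?subr_ge0//.
exact/ltW/phi_gt0.
Qed.

Lemma fmix_gt0 gamma delta s z : 0 < gamma -> 0 <= delta -> 0 < s <= 1 ->
  0 < fmix gamma delta s z.
Proof.
move=> g0 d0 s01; apply: lt_le_trans (fmix_ge z g0 d0 s01).
by case/andP: s01 => s0 _; rewrite !mulr_gt0 ?Cnorm_gt0 ?gmix_gt0.
Qed.

(** The condition on [V] says exactly that [l^2 / 2 >= 1 / (4 V)], so the normal component decays at
    least as fast as the error term of [gmix_compare]. *)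
Lemma f0_le_exp (V l z : R) : 0 < V -> 1 <= 2 * V * l ^+ 2 ->
  f0 (l * z) <= expR (- z ^+ 2 / (4 * V)).
Proof.
move=> V0 Vl; rewrite /f0 /phi mulr1 -[leRHS]mul1r.
have p2 : 2 <= pi :> R by exact: pi_ge2.
apply: ler_pM; rewrite ?expR_ge0 ?invr_ge0 ?sqrtr_ge0//.
  rewrite invf_le1 ?sqrtr_gt0 ?mulr_gt0 ?pi_gt0// -[leLHS]sqrtr1 ler_wsqrtr//; lra.
rewrite ler_expR mulr1 !mulNr lerN2 ler_pdivrMr ?mulr_gt0// mulrAC ler_pdivlMr//.
rewrite exprMn.
have := sqr_ge0 z; nra.
Qed.

(* [f z >= c * q] and the error terms are [B * q ^+ 2], with
   [q = expR (- z ^+ 2 / (8 * V))]; so it suffices that [B * q] is small. *)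
Lemma fmix_regular gamma delta s (a A e : R) :
  0 < gamma -> 0 <= delta -> 0 < s <= 1 -> 0 < a -> 0 < e ->
  exists Z : R, forall z, Z <= `|z| -> forall l, a <= l <= A ->
  `|l `^ (1 + 2 * delta) * fmix gamma delta s (l * z) / fmix gamma delta s z - 1| <= e.
Proof.
move=> g0 d0 s01 a0 e0; have /andP[s0 s1] := s01.
have e20 : 0 < e / 2 by rewrite divr_gt0.
have [V0 [_ HV0]] := @Hraw_scale_near R gamma delta a A (e / 2) a0 e20.
(* [V0] serves the comparison of densities; [1] and [(a^2)^-1] make [f0_le_exp] applicable at scale
   1 and at every scale [l >= a]. *)
pose V := Num.max V0 (Num.max 1 (a ^+ 2)^-1).
have V0V : V0 <= V by rewrite le_max lexx.
have V1 : 1 <= V by rewrite !le_max lexx orbT.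
have Va : (a ^+ 2)^-1 <= V by rewrite !le_max lexx !orbT.
clearbody V.
have V_gt0 : 0 < V by lra.
have a20 : 0 < a ^+ 2 by rewrite exprn_gt0.
have aV : 1 <= V * a ^+ 2 by rewrite -ler_pdivrMr// div1r.
have HV v : V < v -> _ := fun Vv => HV0 v (le_lt_trans V0V Vv).
have [c c0 Hc] := gmix_lower g0 d0 V_gt0.
have C0 := Cnorm_gt0 g0 d0; set C := Cnorm gamma delta in C0.
pose K := 2 * ((A ^+ 2) `^ (1 + delta) + 1) * V.
have K0 : 0 < K by rewrite !mulr_gt0// ltr_wpDl// powR_ge0.
pose L := A `^ (1 + 2 * delta).
(* [L + 1] comes from the normal component, [C * K] from the small variances in [gmix_compare]. *)
pose B := L + 1 + C * K.
have L0 : 0 <= L by exact: powR_ge0.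
have B0 : 0 < B by rewrite /B; have := mulr_gt0 C0 K0; lra.
(* One half of [e] is the relative error for large variances; the other half, times the constant in
   the lower bound on [fmix], is what [B * q] may use up. *)
pose t := e / 2 * (s * C * c).
have t0 : 0 < t by rewrite !mulr_gt0.
(* The summand 1 gives [|z| >= 1], hence [z^2 >= |z|]; the other one bounds [z^2] from below by
   [8 V B / t]. *)
exists (1 + 8 * V * B / t) => z Zz l alA; have /andP[al lA] := alA.
have l0 := lt_le_trans a0 al.
have M0 : 0 < 8 * V * B / t by rewrite divr_gt0// !mulr_gt0.
have z1 : 1 <= `|z| by apply: le_trans Zz; rewrite lerDl ltW.
have z2 : 8 * V * B / t <= z ^+ 2.
  rewrite -[z ^+ 2]ger0_norm ?sqr_ge0// normrX expr2.
  by apply: (@le_trans _ _ (1 * `|z|)); [lra|rewrite ler_wpM2r].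
have zz0 : 0 < z ^+ 2 by exact: lt_le_trans z2.
pose q := expR (- z ^+ 2 / (8 * V)).
pose E := expR (- z ^+ 2 / (4 * V)).
have q0 : 0 < q by exact: expR_gt0.
have EE : E = q * q by rewrite /E /q -expRD; congr expR; field; rewrite gt_eqF.
(* The inequality [x <= exp x] at [x = z^2 / (8 V)] gives [q * z^2 <= 8 V], to be combined with
   [z2]. *)
have qle : B * q <= t.
  have qinv : 1 <= q * expR (z ^+ 2 / (8 * V)).
    by rewrite /q -expRD mulNr addNr expR0.
  have ex : z ^+ 2 / (8 * V) <= expR (z ^+ 2 / (8 * V)).
    by apply: le_trans (expR_ge1Dx _); rewrite lerDr.
  have qz : q * z ^+ 2 <= 8 * V.
    have : q * (z ^+ 2 / (8 * V)) <= 1.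
      apply: (@le_trans _ _ (q * expR (z ^+ 2 / (8 * V)))).
        by rewrite ler_wpM2l// ltW.
      by rewrite /q -expRD mulNr addNr expR0.
    by rewrite mulrA ler_pdivrMr ?mul1r// mulr_gt0.
  have h1 : 8 * V * B <= t * z ^+ 2 by move: z2; rewrite ler_pdivrMr// [leRHS]mulrC.
  have : B * (q * z ^+ 2) <= t * z ^+ 2.
    by apply: le_trans h1; rewrite [leRHS]mulrC ler_wpM2l// ltW.
  by rewrite mulrA ler_pM2r.
have f_gt0 := fmix_gt0 z g0 d0 s01.
have f_ge := fmix_ge z g0 d0 s01.
rewrite -[X in _ - X](divff (lt0r_neq0 f_gt0)) -mulrBl normrM normfV.
rewrite (gtr0_norm f_gt0) ler_pdivrMr//.
have cmp := gmix_compare g0 d0 a0 V_gt0 (ltW e20) HV z1 alA.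
rewrite -/K -/E in cmp.
set p := l `^ _ in cmp *.
have p0 : 0 <= p by exact: powR_ge0.
have pL : p <= L.
  apply: (ge0_ler_powR _ _ _ lA); first by rewrite addr_ge0// mulr_ge0.
    by rewrite nnegrE ltW.
  by rewrite nnegrE (le_trans (ltW l0)).
have f0l : f0 (l * z) <= E.
  apply: f0_le_exp => //; have : a ^+ 2 <= l ^+ 2 by rewrite lerXn2r// nnegrE ltW.
  by nra.
have f0z : f0 z <= E.
  by rewrite -[z in f0 z]mul1r; apply: f0_le_exp => //; rewrite expr1n; lra.
have f0l0 : 0 <= f0 (l * z) by exact/ltW/phi_gt0.
have f0z0 : 0 <= f0 z by exact/ltW/phi_gt0.
have E0 : 0 < E by exact: expR_gt0.
have -> : p * fmix gamma delta s (l * z) - fmix gamma delta s z =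
  (1 - s) * (p * f0 (l * z) - f0 z) +
  s * C * (p * gmix gamma delta (l * z) - gmix gamma delta z).
  by rewrite /fmix !f1E// -/C; ring.
have h1 : `|p * f0 (l * z) - f0 z| <= (L + 1) * E.
  have u1 : p * f0 (l * z) <= L * E by exact: ler_pM.
  have u2 : 0 <= p * f0 (l * z) by exact: mulr_ge0.
  by rewrite ler_norml; apply/andP; split; nra.
have sC0 : 0 < s * C by rewrite mulr_gt0.
apply: (le_trans (ler_normD _ _)).
rewrite !normrM (ger0_norm (_ : 0 <= 1 - s)) ?subr_ge0// (gtr0_norm s0) (gtr0_norm C0).
have b1 : (1 - s) * `|p * f0 (l * z) - f0 z| <= (L + 1) * E.
  by apply: le_trans h1; rewrite ler_piMl//; lra.
have b2 : s * C * `|p * gmix gamma delta (l * z) - gmix gamma delta z| <=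
    e / 2 * (s * C * gmix gamma delta z) + C * K * E.
  apply: (@le_trans _ _ (s * C * (e / 2 * gmix gamma delta z + K * E))).
    by rewrite ler_wpM2l// ltW.
  have : s * (C * K * E) <= C * K * E.
    by rewrite ler_piMl//; apply/ltW/mulr_gt0 => //; exact: mulr_gt0.
  by lra.
have b3 : e / 2 * (s * C * gmix gamma delta z) <= e / 2 * fmix gamma delta s z.
  by rewrite ler_wpM2l// ltW.
have b4 : B * E <= e / 2 * fmix gamma delta s z.
  rewrite EE mulrA.
  apply: (@le_trans _ _ (t * q)); first by rewrite ler_wpM2r// ltW.
  rewrite /t -mulrA ler_wpM2l ?(ltW e20)//.
  apply: le_trans f_ge; rewrite -mulrA ler_wpM2l ?(ltW sC0)//; exact: Hc.
have : B * E = (L + 1) * E + C * K * E by rewrite /B; ring.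
by lra.
Qed.

End mixture_regular_variation.

(** * Finite products near 1 and bounds on compact parameter sets *)

Lemma prod_near1 (R : realFieldType) (I : Type) (r : seq I) (Q : pred I) (e : R) :
  0 < e -> exists2 e1 : R, 0 < e1 &
  forall F : I -> R, (forall i, Q i -> `|F i - 1| <= e1) ->
  `|\prod_(i <- r | Q i) F i - 1| <= e.
Proof.
elim: r e => [|i r IH] e e0.
  by exists 1 => // F _; rewrite big_nil subrr normr0 ltW.
have m0 : 0 < Num.min 1 (e / 3) by rewrite lt_min ltr01 divr_gt0.
have [e1 e10 H1] := IH _ m0.
(* The head factor has to meet the tolerance of [mul_near1] itself, the tail product meets it
   through [e1]. *)
exists (Num.min e1 (Num.min 1 (e / 3))); first by rewrite lt_min e10 m0.
move=> F HF; have HF1 j : Q j -> `|F j - 1| <= e1.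
  by move=> /HF /le_trans; apply; rewrite ge_min lexx.
rewrite big_cons; case: ifPn => [Qi|_].
  apply: mul_near1; last exact: H1.
  by apply: (le_trans (HF _ Qi)); rewrite ge_min lexx orbT.
apply: (le_trans (H1 _ HF1)).
by rewrite ge_min; apply/orP; right; rewrite ler_pdivrMr// ler_peMr ?ltW//; lra.
Qed.

Lemma compact_continuous_bounded (R : realType) (T : topologicalType)
  (K : set T) (f : T -> R) : compact K -> {within K, continuous f} ->
  exists M : R, forall x, K x -> `|f x| <= M.
Proof.
move=> cK cf.
have /compact_bounded [M [_ HM]] := continuous_compact cf cK.
exists (M + 1) => x Kx; apply: (HM (M + 1)); first by rewrite ltrDl.
by exists x.
Qed.

(** Makes the shift of each observation by its linear predictor bounded on a compact parameter
    set. *)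
Lemma continuous_mulmx_entry (R : realType) (n p : nat) (X : 'M[R]_(n, p)) (i : 'I_n) :
  continuous (fun bs : 'cV[R]_p * R => (X *m bs.1) i 0 : R).
Proof.
rewrite (_ : (fun _ => _) = (fun bs : 'cV[R]_p * R => \sum_j X i j * bs.1 j 0)); last first.
  by apply/funext => bs; rewrite mxE.
apply: continuous_big => [|j _ bs]; first exact: add_continuous.
apply: cvgM; first exact: cvg_cst.
apply: (@cvg_comp _ _ _ fst (fun b : 'cV[R]_p => b j 0) _ (nbhs bs.1)).
  exact: cvg_fst.
exact: coord_continuous.
Qed.

(** * Location and scale change of a single distant observation *)

Section shifted_ratio.
Variable R : realType.
Implicit Types (gamma delta s : R).

(** With [t = 1 - b / y] and [l = t / sigma], the factor [sigma^(-1 - 2 delta)] equals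
    [l^(1 + 2 delta) * t^(- (1 + 2 delta))]. The quantity is thus the ratio of [fmix_regular] times
    a power of [t], and both are close to 1. *)
Lemma fmix_shift_ratio gamma delta s (a A B e : R) :
  0 < gamma -> 0 <= delta -> 0 < s <= 1 -> 0 < a -> 0 < e ->
  exists Z : R, forall y, Z <= `|y| -> forall sigma b, a <= sigma <= A -> `|b| <= B ->
  `|sigma^-1 * fmix gamma delta s ((y - b) / sigma) / fmix gamma delta s y /
    sigma `^ (2 * delta) - 1| <= e.
Proof.
move=> g0 d0 s01 a0 e0; pose e1 := Num.min 1 (e / 3).
have e10 : 0 < e1 by rewrite lt_min ltr01 divr_gt0.
have /cvgrPdist_lt /(_ _ e10) [d /= d_gt0 Hd] := @cvg_powR1 R (- (1 + 2 * delta)).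
(* This and [2 / a] will enclose [l], since [t] lies in [[1/2, 2]] and [sigma] in [[a, A]]. *)
have A0 : 0 < (2 * (`|A| + 1))^-1 by rewrite invr_gt0 mulr_gt0// ltr_wpDl.
have [Z HZ] := fmix_regular (2 / a) g0 d0 s01 A0 e10.
(* [1 + 2 |B|] forces [y != 0] and [|b / y| <= 1/2]; adding [|B| / d] forces [|1 - t| < d]. *)
exists (Num.max Z (1 + 2 * `|B| + `|B| / d)) => y; rewrite ge_max => /andP[Zy yB].
move=> sigma b /andP[asigma sigmaA] bB.
have sigma0 := lt_le_trans a0 asigma.
have bB' : `|b| <= `|B| by exact: le_trans bB (ler_norm _).
have Bd0 : 0 <= `|B| / d by rewrite divr_ge0// ltW.
have B0 := normr_ge0 B.
have ny0 : 0 < `|y| by lra.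
have y0 : y != 0 by rewrite -normr_gt0.
pose t := 1 - b / y.
have tE : `|1 - t| = `|b| / `|y| by rewrite /t opprB addrC subrK normrM normfV.
have td : `|1 - t| < d.
  rewrite tE ltr_pdivrMr// mulrC -ltr_pdivrMr//.
  by apply: (@le_lt_trans _ _ (`|B| / d)); [rewrite ler_pM2r// invr_gt0|lra].
have t12 : `|1 - t| <= 2^-1 by rewrite tE ler_pdivrMr//; lra.
have t1 : 2^-1 <= t by move: t12; rewrite ler_norml; lra.
have t2 : t <= 2 by move: t12; rewrite ler_norml; lra.
have t0 : 0 < t by lra.
pose l := t / sigma.
have l0 : 0 < l by rewrite divr_gt0.
have lE : (y - b) / sigma = l * y by rewrite /l /t; field; rewrite y0 gt_eqF.
have lb : (2 * (`|A| + 1))^-1 <= l <= 2 / a.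
  apply/andP; split.
    rewrite /l invfM; apply: ler_pM; rewrite ?invr_ge0 ?addr_ge0//.
    rewrite lef_pV2 ?posrE ?ltr_wpDl//.
    by have := ler_norm A; lra.
  by apply: ler_pM; rewrite ?(ltW t0) ?invr_ge0 ?(ltW sigma0)// lef_pV2.
have fac : sigma^-1 / sigma `^ (2 * delta) = l `^ (1 + 2 * delta) * t `^ (- (1 + 2 * delta)).
  have -> : l `^ (1 + 2 * delta) = t `^ (1 + 2 * delta) * sigma `^ (- (1 + 2 * delta)).
    rewrite /l powRM ?invr_ge0 ?(ltW t0) ?(ltW sigma0)//; congr (_ * _).
    by rewrite -powR_inv1 ?(ltW sigma0)// -powRrM mulN1r.
  rewrite mulrAC powRN mulfV ?mul1r ?gt_eqF ?powR_gt0//.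
  rewrite powRN powRD; last by rewrite (gt_eqF sigma0) implybT.
  by rewrite powRr1 ?(ltW sigma0)// invfM.
rewrite [X in `|X - 1|](_ : _ =
  (l `^ (1 + 2 * delta) * fmix gamma delta s (l * y) / fmix gamma delta s y) *
  t `^ (- (1 + 2 * delta))); last first.
  rewrite lE; transitivity ((sigma^-1 / sigma `^ (2 * delta)) *
    (fmix gamma delta s (l * y) / fmix gamma delta s y)); first by ring.
  by rewrite fac; ring.
apply: mul_near1; first exact: HZ.
by rewrite distrC ltW// Hd.
Qed.

End shifted_ratio.

(** An exact identity: the prior and the factors over [K] are positive and cancel. The limit is
    shared out as one [sigma^(2 delta)] per index outside [K], so that each remaining factor is the
    quantity controlled by [fmix_shift_ratio]. *)
Lemma upost_ratio (R : realType) (gamma delta s : R) (n p : nat)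
  (X : 'M[R]_(n, p)) (prior : 'cV[R]_p -> R -> R)
  (K : {set 'I_n}) (y : 'I_n -> R) (beta : 'cV[R]_p) (sigma : R) :
  0 < gamma -> 0 <= delta -> 0 < s <= 1 -> 0 < sigma -> 0 < prior beta sigma ->
  upost gamma delta s X prior [set: 'I_n] y beta sigma
    / upost gamma delta s X prior K y beta sigma
    / \prod_(i in ~: K) fmix gamma delta s (y i) =
  sigma `^ (2 * #|~: K|%:R * delta) *
  \prod_(i in ~: K) (sigma^-1 * fmix gamma delta s ((y i - (X *m beta) i 0) / sigma)
    / fmix gamma delta s (y i) / sigma `^ (2 * delta)).
Proof.
move=> g0 d0 s01 sigma0 prior0; rewrite /upost.
set F := fun i => sigma^-1 * fmix gamma delta s ((y i - (X *m beta) i 0) / sigma).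
have F0 i : 0 < F i by rewrite mulr_gt0 ?invr_gt0// fmix_gt0.
have -> : \prod_(i in [set: 'I_n]%SET) F i = \prod_(i in K) F i * \prod_(i in ~: K) F i.
  rewrite (bigID (mem K))/=; congr (_ * _); apply: eq_bigl => i; first by rewrite !inE.
  by rewrite !inE.
have PK0 : 0 < \prod_(i in K) F i by apply: prodr_gt0.
have -> : prior beta sigma * (\prod_(i in K) F i * \prod_(i in ~: K) F i) /
    (prior beta sigma * \prod_(i in K) F i) = \prod_(i in ~: K) F i.
  by field; rewrite !gt_eqF.
have -> : sigma `^ (2 * #|~: K|%:R * delta) = \prod_(i in ~: K) sigma `^ (2 * delta).
  rewrite prodr_const -powR_mulrn ?powR_ge0// -powRrM; congr (_ `^ _); ring.
rewrite -prodf_div -big_split/=; apply: eq_bigr => i _.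
by rewrite [RHS]mulrC divfK// gt_eqF// powR_gt0.
Qed.

Theorem theoremS1 (R : realType) (gamma delta s : R) (n p : nat)
  (X : 'M[R]_(n, p)) (prior : 'cV[R]_p -> R -> R)
  (Kset : {set 'I_n}) (y : R -> 'I_n -> R) (Kc : set ('cV[R]_p * R)) :
  0 < gamma -> 0 <= delta -> 0 < s <= 1 ->
  (forall beta sigma, 0 < sigma -> 0 < prior beta sigma) ->
  (forall i, i \in Kset -> forall w w', y w i = y w' i) ->
  (forall i, i \notin Kset -> `|y w i| @[w --> +oo] --> +oo) ->
  compact Kc -> Kc `<=` [set bs | 0 < bs.2] ->
  forall eps : R, 0 < eps ->
  exists M : R, forall w : R, M < w ->
  forall beta sigma, Kc (beta, sigma) ->
  `| upost gamma delta s X prior [set: 'I_n] (y w) beta sigma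
       / upost gamma delta s X prior Kset (y w) beta sigma
       / \prod_(i in ~: Kset) fmix gamma delta s (y w i)
     - sigma `^ (2 * #|~: Kset|%:R * delta) | < eps.
Proof.
move=> g0 d0 s01 prior0 _ yinf cK K0 eps eps0.
pose N : R := #|~: Kset|%:R; have N0 : 0 <= N by exact: ler0n.
have [A HA] : exists A : R, forall bs, Kc bs -> `|bs.2| <= A.
  apply: (compact_continuous_bounded cK); apply: continuous_subspaceT => bs.
  exact: cvg_snd.
(* Compactness inside [sigma > 0] keeps [sigma] away from 0: its inverse is continuous on [Kc],
   hence bounded. *)
have [a' Ha'] : exists a : R, forall bs, Kc bs -> `|bs.2^-1| <= a.
  apply: (compact_continuous_bounded cK); apply: continuous_in_subspaceT => bs.
  rewrite inE => /K0 /= bs0; apply: cvgV; first by rewrite gt_eqF.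
  exact: cvg_snd.
pose a := (`|a'| + 1)^-1.
have a0 : 0 < a by rewrite invr_gt0 ltr_wpDl.
have aA sigma beta : Kc (beta, sigma) -> a <= sigma <= A.
  move=> Kbs; have s0 : 0 < sigma by exact: (K0 _ Kbs).
  apply/andP; split; last by apply: le_trans (ler_norm _) (HA _ Kbs).
  rewrite -[sigma]invrK lef_pV2 ?posrE ?invr_gt0 ?ltr_wpDl//.
  apply: (le_trans (ler_norm _)); apply: (le_trans (Ha' _ Kbs)).
  by have := ler_norm a'; lra.
(* [T] bounds the limit on [Kc], so a relative error [eps / (2 T)] gives an absolute error of at
   most [eps / 2]. *)
pose T := `|A| `^ (2 * N * delta) + 1.
have T0 : 0 < T by rewrite ltr_wpDl// powR_ge0.
have e0 : 0 < eps / (2 * T) by rewrite divr_gt0// mulr_gt0.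
have [e1 e10 He1] := @prod_near1 R _ (index_enum 'I_n) (fun i => i \in ~: Kset) _ e0.
have : \forall w \near +oo, forall i, i \in ~: Kset ->
    forall beta sigma, Kc (beta, sigma) ->
  `|sigma^-1 * fmix gamma delta s ((y w i - (X *m beta) i 0) / sigma) /
    fmix gamma delta s (y w i) / sigma `^ (2 * delta) - 1| <= e1.
  (* The index set is finite, so it suffices to treat each index separately; for those in [Kset] the
     claim is vacuous. *)
  apply: filter_forall => i; have [iL|iK] := boolP (i \in ~: Kset); last by near=> w.
  have [B HB] := compact_continuous_bounded cK
    (continuous_subspaceT (@continuous_mulmx_entry R n p X i)).
  have [Z HZ] := fmix_shift_ratio A B g0 d0 s01 a0 e10.
  have iL' : i \notin Kset by move: iL; rewrite inE.
  have /cvgryPge/(_ Z) := yinf i iL'; apply: filterS => w Zw _ beta sigma Kbs.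
  by apply: HZ => //; [exact: aA Kbs|exact: HB Kbs].
move=> [M [_ HM]]; exists M => w Mw beta sigma Kbs.
have sigma0 : 0 < sigma by exact: (K0 _ Kbs).
rewrite upost_ratio ?prior0// -[X in _ - X]mulr1 -mulrBr normrM.
have sT : `|sigma `^ (2 * #|~: Kset|%:R * delta)| <= T.
  rewrite ger0_norm ?powR_ge0//.
  have sA : sigma <= `|A| by have /andP[_ /le_trans] := aA _ _ Kbs; apply; exact: ler_norm.
  apply: (@le_trans _ _ (`|A| `^ (2 * N * delta))); last by rewrite lerDl.
  by apply: (ge0_ler_powR _ _ _ sA); rewrite ?nnegrE ?(ltW sigma0)// !mulr_ge0.
apply: (@le_lt_trans _ _ (T * (eps / (2 * T)))).
  apply: ler_pM => //; apply: He1 => i iL.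
  exact: (HM w Mw i iL).
have -> : T * (eps / (2 * T)) = eps / 2 by field; rewrite gt_eqF.
lra.
Unshelve. all: by end_near. Qed.
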